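(* Let $\mathbb{K}$ be a field and let $S=\mathbb{K}[x_1,x_2,x_3,x_4]$ be the nonstandard $\mathbb{Z}$-graded polynomial ring with $\deg(x_1)=1$, $\deg(x_2)=4$, $\deg(x_3)=7$, $\deg(x_4)=9$. If $e$ is an integer with $e\geq 21$ and $e\equiv 3 \pmod 9$, then the Veronese subring $S^{(e)}$ is not nonstandard Koszul.
   Context: For a positively $\mathbb{Z}$-graded $\mathbb{K}$-algebra $A=\bigoplus_{d\geq 0}A_d$ and an integer $e\geq 1$, the $e$-th Veronese subring is $A^{(e)}=\bigoplus_{k\geq 0}A_{ek}$. A standard $\mathbb{Z}$-graded $\mathbb{K}$-algebra $B$ (that is, $B_0=\mathbb{K}$ and $B$ is generated over $\mathbb{K}$ by a finite-dimensional $B_1$) is Koszul if the minimal graded $B$-free resolution of the residue field $\mathbb{K}=B/B_+$ is linear, i.e. $\operatorname{Tor}^B_i(\mathbb{K},\mathbb{K})_j=0$ whenever $i\neq j$. Let $A$ be a finitely generated positively $\mathbb{Z}$-graded $\mathbb{K}$-algebra with $A_0=\mathbb{K}$ and $\mathfrak{m}=A_+$ its homogeneous maximal ideal. $A$ is nonstandard Koszul if the associated graded ring $\operatorname{gr}_{\mathfrak{m}}(A)=\bigoplus_{k\geq 0}\mathfrak{m}^k/\mathfrak{m}^{k+1}$ is Koszul as a standard $\mathbb{Z}$-graded $\mathbb{K}$-algebra (graded by $k$). *)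

(* Defs.v *)
From HB Require Import structures.
From mathcomp Require Import all_boot all_order all_algebra.
From mathcomp Require Import boolp classical_sets.
From mathcomp Require Import mpoly.

Set Implicit Arguments.
Unset Strict Implicit.
Unset Printing Implicit Defensive.

Import GRing.Theory.
Local Open Scope ring_scope.
Local Open Scope quotient_scope.

(* Commutative K-algebras A = (+)_(d >= 0) A_d with A_0 = K; the subspace A_d *)
(* of the carrier is gcomp d.                                                 *)
Record gradedAlg (K : fieldType) := GradedAlg {
  gcarrier :> comAlgType K;
  gcomp : nat -> set gcarrier;
  gcomp0 : forall d, gcomp d 0;
  gcompP : forall d (c : K) x y, gcomp d x -> gcomp d y -> gcomp d (c *: x + y);
  gcompM : forall i j x y, gcomp i x -> gcomp j y -> gcomp (i + j) (x * y);
  gcomp_deg0 : forall x, gcomp 0 x <-> exists c : K, x = c%:A;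
  gcomp_span : forall x, exists n (f : nat -> gcarrier),
    (forall d, gcomp d (f d)) /\ x = \sum_(d < n) f d;
  gcomp_direct : forall n (f : nat -> gcarrier),
    (forall d, gcomp d (f d)) -> \sum_(d < n) f d = 0 ->
    forall d, (d < n)%N -> f d = 0
}.
Arguments gcomp {K g} d _ : rename.

(* The subspace (+)_k A_(delta k), for delta injective. *)
Definition gspan (K : fieldType) (A : gradedAlg K) (delta : nat -> nat) : set A :=
  [set x | exists n (f : nat -> A),
     (forall k, gcomp (delta k) (f k)) /\ x = \sum_(k < n) f k].
Arguments gspan {K} A delta _.

Definition irrelevant (K : fieldType) (A : gradedAlg K) : set A := gspan A succn.
Arguments irrelevant {K} A _.

Section GradedTheory.
Variables (K : fieldType) (A : gradedAlg K).
Implicit Types (x y : A) (d : nat) (delta : nat -> nat).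

Lemma gcompD d x y : gcomp d x -> gcomp d y -> gcomp d (x + y).
Proof. by move=> hx hy; rewrite -[x]scale1r; apply: gcompP. Qed.

Lemma gcompZ d (c : K) x : gcomp d x -> gcomp d (c *: x).
Proof. by move=> hx; rewrite -[c *: x]addr0; apply: gcompP => //; apply: gcomp0. Qed.

Lemma gcomp1 : gcomp (g := A) 0 1.
Proof. by apply/gcomp_deg0; exists 1; rewrite scale1r. Qed.

Lemma gcomp_cut delta n m (f : nat -> A) :
  (forall d, gcomp (delta d) (f d)) -> (n <= m)%N ->
  exists g : nat -> A, (forall d, gcomp (delta d) (g d)) /\
    \sum_(d < n) f d = \sum_(d < m) g d.
Proof.
move=> hf nm; exists (fun d => if (d < n)%N then f d else 0); split.
  by move=> d; case: ifP => _ //; apply: gcomp0.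
by rewrite (big_ord_widen_cond m xpredT f nm) /= big_mkcond.
Qed.

Lemma gspan0 delta : gspan A delta 0.
Proof. by exists 0, (fun=> 0); split; [move=> *; apply: gcomp0|rewrite big_ord0]. Qed.

Lemma gspanP delta (c : K) x y :
  gspan A delta x -> gspan A delta y -> gspan A delta (c *: x + y).
Proof.
move=> [n [f [hf ->]]] [m [g [hg ->]]].
have [f' [hf' ->]] := gcomp_cut hf (leq_maxl n m).
have [g' [hg' ->]] := gcomp_cut hg (leq_maxr n m).
exists (maxn n m), (fun k => c *: f' k + g' k); split.
  by move=> k; apply: gcompP.
by rewrite scaler_sumr -big_split.
Qed.

Lemma gspanD delta x y :
  gspan A delta x -> gspan A delta y -> gspan A delta (x + y).
Proof. by move=> hx hy; rewrite -[x]scale1r; apply: gspanP. Qed.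

Lemma gspan_sum delta (I : Type) (r : seq I) (P : pred I) (F : I -> A) :
  (forall i, P i -> gspan A delta (F i)) ->
  gspan A delta (\sum_(i <- r | P i) F i).
Proof. by move=> h; apply: big_ind => //; [apply: gspan0 | apply: gspanD]. Qed.

Lemma gspan_gcomp delta k x : gcomp (delta k) x -> gspan A delta x.
Proof.
move=> hx; exists k.+1, (fun j => if j == k then x else 0); split.
  by move=> j; case: eqP => [->|_] //; apply: gcomp0.
rewrite big_ord_recr /= eqxx big1 ?add0r // => i _.
by rewrite (ltn_eqF (ltn_ord i)).
Qed.

Lemma irrelevantD x y : irrelevant A x -> irrelevant A y -> irrelevant A (x + y).
Proof. exact: gspanD. Qed.

Lemma irrelevantM x y : irrelevant A y -> irrelevant A (x * y).
Proof.
move=> [m [g [hg ->]]]; have [n [f [hf ->]]] := gcomp_span x.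
rewrite big_distrl; apply: gspan_sum => i _.
rewrite big_distrr; apply: gspan_sum => j _.
by apply: (@gspan_gcomp _ (i + j)); rewrite -addnS; apply: gcompM.
Qed.

Lemma irrelevant1 : ~ irrelevant A 1.
Proof.
move=> [n [f [hf e]]].
pose g k := if k is k'.+1 then - f k' else 1 : A.
have hg d : gcomp d (g d).
  case: d => [|d] /=; first exact: gcomp1.
  by rewrite -scaleN1r; apply: gcompZ.
have h0 : \sum_(d < n.+1) g d = 0.
  by rewrite big_ord_recl /= [X in X + _]e -big_split big1 //= => i _; rewrite subrr.
by move/eqP: (gcomp_direct hg h0 (ltn0Sn n)); rewrite oner_eq0.
Qed.

End GradedTheory.

(* [idealX I k] is the power I^k of the ideal I. *)
Fixpoint idealX (R : comNzRingType) (I : set R) (k : nat) : set R :=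
  if k is k'.+1 then
    [set x | exists2 s : seq (R * R),
       forall p, p \in s -> I p.1 /\ idealX I k' p.2 & x = \sum_(p <- s) p.1 * p.2]
  else setT.

Section PowerTheory.
Variables (K : fieldType) (A : gradedAlg K).
Local Notation mX := (idealX (irrelevant A)).

Lemma mX0 k : mX k 0.
Proof. by case: k => [//|k]; exists [::]; rewrite ?big_nil. Qed.

Lemma mXD k x y : mX k x -> mX k y -> mX k (x + y).
Proof.
case: k => [//|k] [s hs ->] [t ht ->]; exists (s ++ t); rewrite ?big_cat //.
by move=> p; rewrite mem_cat => /orP[/hs|/ht].
Qed.

Lemma mX_sum k (I : Type) (r : seq I) (P : pred I) (F : I -> A) :
  (forall i, P i -> mX k (F i)) -> mX k (\sum_(i <- r | P i) F i).
Proof. by move=> h; apply: big_ind => //; [apply: mX0 | apply: mXD]. Qed.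

Lemma mX_mulS k x y : irrelevant A x -> mX k y -> mX k.+1 (x * y).
Proof.
move=> hx hy; exists [:: (x, y)]; last by rewrite big_seq1.
by move=> p; rewrite inE => /eqP ->.
Qed.

Lemma mXM i j x y : mX i x -> mX j y -> mX (i + j) (x * y).
Proof.
elim: i x => [|i IH] x.
  move=> _; case: j => [//|j] [s hs ->]; rewrite big_distrr big_seq.
  apply: mX_sum => p /hs[h1 h2] /=; rewrite mulrA.
  by apply: mX_mulS => //; apply: irrelevantM.
move=> [s hs ->] hy; rewrite big_distrl big_seq addSn.
apply: mX_sum => p /hs[h1 h2] /=; rewrite -mulrA.
by apply: mX_mulS => //; apply: IH.
Qed.

Lemma mXMl k x y : mX k y -> mX k (x * y).
Proof. exact: (@mXM 0). Qed.

Lemma mXN k x : mX k x -> mX k (- x).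
Proof. by rewrite -mulN1r; apply: mXMl. Qed.

Lemma mX1E x : mX 1 x <-> irrelevant A x.
Proof.
split=> [[s hs ->]|hx]; last by rewrite -[x]mulr1; apply: mX_mulS.
rewrite big_seq; apply: big_ind => [||p /hs[hp _]].
- exact: gspan0.
- exact: irrelevantD.
- by rewrite mulrC; apply: irrelevantM.
Qed.

End PowerTheory.

(* gr_m(A) = (+)_k m^k / m^(k+1), with m = A_+: the ring of finite families   *)
(* (a_k)_k with a_k in m^k under componentwise addition and convolution, i.e. *)
(* polynomials over A, modulo the families with a_k in m^(k+1) for all k.     *)
Section AssociatedGraded.
Variables (K : fieldType) (A : gradedAlg K).
Local Notation mX := (idealX (irrelevant A)).

Definition rees : {pred {poly A}} := fun p => `[< forall k, mX k p`_k >].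

Lemma reesP (p : {poly A}) : reflect (forall k, mX k p`_k) (p \in rees).
Proof. exact: asboolP. Qed.

Lemma rees_subring_closed : subring_closed rees.
Proof.
split.
- by apply/reesP=> -[|k]; [exact: I | rewrite coefC; apply: mX0].
- move=> p q /reesP hp /reesP hq; apply/reesP=> k; rewrite coefB.
  by apply: mXD => //; apply: mXN.
- move=> p q /reesP hp /reesP hq; apply/reesP=> k; rewrite coefM.
  apply: mX_sum => i _; rewrite -[X in mX X](subnKC (ltn_ord i : (i <= k)%N)).
  exact: mXM.
Qed.

HB.instance Definition _ :=
  GRing.isSubringClosed.Build {poly A} rees rees_subring_closed.

Record reesRing := Rees { rees_val :> {poly A}; _ : rees_val \in rees }.
HB.instance Definition _ := [isSub for rees_val].
HB.instance Definition _ := [Choice of reesRing by <:].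
HB.instance Definition _ := [SubChoice_isSubComNzRing of reesRing by <:].

Lemma rees_val_zmod : zmod_morphism rees_val.
Proof. exact: (raddfB (val : reesRing -> {poly A})). Qed.

Lemma rees_val_monoid : monoid_morphism rees_val.
Proof. by split; [exact: (rmorph1 (val : reesRing -> {poly A}))
                 |exact: (rmorphM (val : reesRing -> {poly A}))]. Qed.

HB.instance Definition _ :=
  GRing.isZmodMorphism.Build reesRing {poly A} rees_val rees_val_zmod.
HB.instance Definition _ :=
  GRing.isMonoidMorphism.Build reesRing {poly A} rees_val rees_val_monoid.

Lemma rees_valD p q : rees_val (p + q) = rees_val p + rees_val q.
Proof. exact: rmorphD. Qed.

Lemma rees_valM p q : rees_val (p * q) = rees_val p * rees_val q.
Proof. exact: rmorphM. Qed.

Definition reesIdeal : {pred reesRing} :=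
  fun p => `[< forall k, mX k.+1 (rees_val p)`_k >].

Lemma reesIdealP (p : reesRing) :
  reflect (forall k, mX k.+1 (rees_val p)`_k) (p \in reesIdeal).
Proof. exact: asboolP. Qed.

Lemma reesIdeal_closed : idealr_closed reesIdeal.
Proof.
split.
- by apply/reesIdealP=> k; rewrite raddf0 coef0; apply: mX0.
- apply/reesIdealP=> /(_ 0%N); rewrite rmorph1 coef1 => /mX1E.
  exact: irrelevant1.
- move=> a u v /reesIdealP hu /reesIdealP hv; apply/reesIdealP=> k.
  rewrite rmorphD rmorphM coefD; apply: mXD => //.
  rewrite coefM; apply: mX_sum => i _.
  rewrite -[X in mX X.+1](subnKC (ltn_ord i : (i <= k)%N)) -addnS.
  by apply: mXM => //; apply/reesP/(valP a).
Qed.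

HB.instance Definition _ :=
  isIdealr.Build reesRing reesIdeal reesIdeal_closed.

Definition grT := {ideal_quot reesIdeal}.
HB.instance Definition _ := GRing.ComNzRing.on grT.
Definition gr_pi (p : reesRing) : grT := \pi_grT p.

Lemma gr_pi_zmod : zmod_morphism gr_pi.
Proof. exact: (raddfB (\pi_grT : reesRing -> {ideal_quot reesIdeal})). Qed.

Lemma gr_pi_monoid : monoid_morphism gr_pi.
Proof.
by split; [exact: (rmorph1 (\pi_grT : reesRing -> {ideal_quot reesIdeal}))
          |exact: (rmorphM (\pi_grT : reesRing -> {ideal_quot reesIdeal}))].
Qed.

HB.instance Definition _ :=
  GRing.isZmodMorphism.Build reesRing grT gr_pi gr_pi_zmod.
HB.instance Definition _ :=
  GRing.isMonoidMorphism.Build reesRing grT gr_pi gr_pi_monoid.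

Lemma gr_piP p q : gr_pi p = gr_pi q <-> forall k, mX k.+1 (rees_val (p - q))`_k.
Proof.
have -> : (gr_pi p = gr_pi q) <-> (p - q \in reesIdeal).
  by rewrite (Quotient.idealrBE reesIdeal p q); split=> [h|/eqP //]; apply/eqP.
by split=> /reesIdealP.
Qed.

Lemma gr_pi_surj (x : grT) : exists p, x = gr_pi p.
Proof. by exists (repr x); rewrite /gr_pi reprK. Qed.

Lemma rees_monomial_subproof k (a : A) : mX k a -> a *: 'X^k \in rees.
Proof.
move=> ha; apply/reesP=> j; rewrite coefZ coefXn.
by case: eqP => [->|_]; rewrite ?mulr1 // mulr0; apply: mX0.
Qed.

Definition rees_monomial k a (ha : mX k a) : reesRing :=
  Rees (rees_monomial_subproof ha).

Definition rees_cst (a : A) : reesRing := @rees_monomial 0 a I.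

Lemma rees_cst_val a : rees_val (rees_cst a) = a%:P.
Proof. by rewrite /= expr0 alg_polyC. Qed.

Lemma rees_val_inj : injective rees_val.
Proof. exact: (val_inj (sT := reesRing)). Qed.

Definition gr_scale (c : K) (x : grT) : grT := gr_pi (rees_cst c%:A) * x.

Lemma gr_scalerA a b v : gr_scale a (gr_scale b v) = gr_scale (a * b) v.
Proof.
rewrite /gr_scale mulrA -rmorphM; congr (gr_pi _ * _); apply: rees_val_inj.
by rewrite rees_valM !rees_cst_val -polyCM mulr_algl scalerA.
Qed.

Lemma gr_scale1r : left_id 1 gr_scale.
Proof.
move=> v; rewrite /gr_scale (_ : rees_cst _ = 1) ?rmorph1 ?mul1r //.
by apply: rees_val_inj; rewrite rees_cst_val scale1r rmorph1.
Qed.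

Lemma gr_scalerDr : right_distributive gr_scale +%R.
Proof. by move=> c u v; apply: mulrDr. Qed.

Lemma gr_scalerDl v : {morph gr_scale^~ v : a b / a + b}.
Proof.
move=> a b; rewrite /gr_scale -mulrDl -rmorphD; congr (gr_pi _ * _).
apply: rees_val_inj.
by rewrite rees_valD !rees_cst_val -polyCD scalerDl.
Qed.

HB.instance Definition _ := GRing.Zmodule_isLmodule.Build K grT
  gr_scalerA gr_scale1r gr_scalerDr gr_scalerDl.

Lemma gr_scalerAl (a : K) (u v : grT) : a *: (u * v) = (a *: u) * v.
Proof. exact: mulrA. Qed.

HB.instance Definition _ := GRing.Lmodule_isLalgebra.Build K grT gr_scalerAl.
HB.instance Definition _ := GRing.Lalgebra_isComAlgebra.Build K grT.

Definition gr_comp (k : nat) : set grT :=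
  [set x | exists (a : A) (ha : mX k a), x = gr_pi (rees_monomial ha)].

Lemma gr_comp0 k : gr_comp k 0.
Proof.
exists 0, (mX0 A k); rewrite -(raddf0 gr_pi); congr gr_pi; apply: rees_val_inj.
by rewrite raddf0 /= scale0r.
Qed.

Lemma gr_compM i j x y : gr_comp i x -> gr_comp j y -> gr_comp (i + j) (x * y).
Proof.
move=> [a [ha ->]] [b [hb ->]]; exists (a * b), (mXM ha hb).
rewrite -rmorphM; congr gr_pi; apply: rees_val_inj.
by rewrite rees_valM /= -scalerAl -scalerAr scalerA exprD.
Qed.

Lemma gr_compD k x y : gr_comp k x -> gr_comp k y -> gr_comp k (x + y).
Proof.
move=> [a [ha ->]] [b [hb ->]]; exists (a + b), (mXD ha hb).
rewrite -rmorphD; congr gr_pi; apply: rees_val_inj.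
by rewrite rees_valD /= scalerDl.
Qed.

Lemma gr_compP k (c : K) x y :
  gr_comp k x -> gr_comp k y -> gr_comp k (c *: x + y).
Proof.
move=> hx hy; apply: gr_compD => //; rewrite -[k]add0n.
by apply: gr_compM => //; exists c%:A, I.
Qed.

Lemma gr_comp_deg0 x : gr_comp 0 x <-> exists c : K, x = c%:A.
Proof.
split=> [[a [ha ->]]|[c ->]]; last first.
  by rewrite -[_%:A]addr0; apply: gr_compP; [exists 1, I | apply: gr_comp0];
     rewrite -(rmorph1 gr_pi); congr gr_pi; apply: rees_val_inj;
     rewrite rmorph1 /= scale1r expr0.
have [n [f [hf ea]]] := gcomp_span a.
have [g [hg eg]] := gcomp_cut hf (leqnSn n).
move: ea; rewrite eg big_ord_recl /= => ea.
have /gcomp_deg0[c ec] := hg 0%N.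
exists c; rewrite /GRing.scale /= /gr_scale mulr1; apply/gr_piP => -[|k].
  rewrite rmorphB coefB /= !expr0 !coefZ !coef1 /= !mulr1 ea ec.
  apply/mX1E; rewrite addrAC subrr add0r; exists n, (fun k => g k.+1).
  by split.
by rewrite rmorphB coefB /= !expr0 !coefZ !coef1 /= !mulr0 subr0; apply: (mX0 A k.+2).
Qed.

Lemma gr_comp_span x : exists n (f : nat -> grT),
  (forall d, gr_comp d (f d)) /\ x = \sum_(d < n) f d.
Proof.
have [p ->] := gr_pi_surj x.
have hp k : mX k (rees_val p)`_k by apply/reesP/(valP p).
exists (size (rees_val p)), (fun k => gr_pi (rees_monomial (hp k))); split.
  by move=> k; exists _, (hp k).
rewrite -rmorph_sum; congr gr_pi; apply: rees_val_inj.
rewrite rmorph_sum /= -[LHS]coefK poly_def.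
by apply: eq_bigr => i _.
Qed.

Lemma gr_comp_direct n (f : nat -> grT) :
  (forall d, gr_comp d (f d)) -> \sum_(d < n) f d = 0 ->
  forall d, (d < n)%N -> f d = 0.
Proof.
move=> /choice[a hf].
have ha d : mX d (a d) by have [] := hf d.
have ef d : f d = gr_pi (rees_monomial (ha d)).
  by have [hd ->] := hf d; congr gr_pi; apply: rees_val_inj.
move=> h0 d dn; rewrite ef; transitivity (gr_pi 0); last exact: raddf0.
have /gr_piP h : gr_pi (\sum_(i < n) rees_monomial (ha i)) = gr_pi 0.
  rewrite rmorph_sum raddf0 -[RHS]h0.
  by apply: eq_bigr => i _; rewrite ef.
apply/gr_piP => k; rewrite subr0 /= coefZ coefXn.
case: eqP => [->|_]; last by rewrite mulr0; apply: (mX0 A k.+1).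
move: (h d); rewrite subr0 (rmorph_sum rees_val) coef_sum (bigD1 (Ordinal dn)) //=.
rewrite coefZ coefXn eqxx big1 ?addr0 // => i ne.
by rewrite coefZ coefXn eq_sym (negbTE (ne : (i : nat) != d)) mulr0.
Qed.

End AssociatedGraded.

Definition gr (K : fieldType) (A : gradedAlg K) : gradedAlg K :=
  @GradedAlg K (grT A) (@gr_comp K A) (@gr_comp0 K A) (@gr_compP K A)
    (@gr_compM K A) (@gr_comp_deg0 K A) (@gr_comp_span K A) (@gr_comp_direct K A).

(* A^(e) = (+)_k A_(ek), with A_(ek) placed in degree k. *)
Section Veronese.
Variables (K : fieldType) (A : gradedAlg K) (e : nat).

Definition veronese_pred : {pred A} := fun x => `[< gspan A (muln e) x >].

Lemma veroneseP (x : A) : reflect (gspan A (muln e) x) (x \in veronese_pred).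
Proof. exact: asboolP. Qed.

Lemma veronese_closed : GRing.subsemialg_closed veronese_pred.
Proof.
have h0 : 0 \in veronese_pred by apply/veroneseP; apply: gspan0.
have hP c x y : x \in veronese_pred -> y \in veronese_pred ->
    c *: x + y \in veronese_pred.
  by move=> /veroneseP hx /veroneseP hy; apply/veroneseP; apply: gspanP.
split.
- by apply/veroneseP/(@gspan_gcomp _ _ _ 0); rewrite muln0; apply: gcomp1.
- by split=> // x y hx hy; rewrite -[x]scale1r; apply: hP.
- by move=> c x hx; rewrite -[c *: x]addr0; apply: hP.
- move=> x y /veroneseP[n [f [hf ->]]] /veroneseP[m [g [hg ->]]].
  apply/veroneseP; rewrite big_distrl; apply: gspan_sum => i _.
  rewrite big_distrr; apply: gspan_sum => j _.
  by apply: (@gspan_gcomp _ _ _ (i + j)); rewrite mulnDr; apply: gcompM.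
Qed.

HB.instance Definition _ :=
  GRing.isSubalgClosed.Build K A veronese_pred veronese_closed.

Record veroneseT :=
  VeroneseT { veronese_val :> A; _ : veronese_val \in veronese_pred }.
HB.instance Definition _ := [isSub for veronese_val].
HB.instance Definition _ := [Choice of veroneseT by <:].
HB.instance Definition _ := [SubChoice_isSubComNzRing of veroneseT by <:].
HB.instance Definition _ := [SubZmodule_isSubLmodule of veroneseT by <:].
HB.instance Definition _ := [SubNzRing_SubLmodule_isSubLalgebra of veroneseT by <:].
HB.instance Definition _ := GRing.Lalgebra_isComAlgebra.Build K veroneseT.

Definition veronese_comp (k : nat) : set veroneseT :=
  [set x | gcomp (e * k) (veronese_val x)].

Lemma veronese_val_inj : injective veronese_val.
Proof. exact: (val_inj (sT := veroneseT)). Qed.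

Lemma veronese_val0 : veronese_val 0 = 0.
Proof. exact: (raddf0 (val : veroneseT -> A)). Qed.

Lemma veronese_valZ (c : K) x : veronese_val (c *: x) = c *: veronese_val x.
Proof. exact: (linearZ_LR (val : veroneseT -> A)). Qed.

Lemma veronese_val1 : veronese_val 1 = 1.
Proof. exact: (rmorph1 (val : veroneseT -> A)). Qed.

Lemma veronese_valD x y : veronese_val (x + y) = veronese_val x + veronese_val y.
Proof. exact: (raddfD (val : veroneseT -> A)). Qed.

Lemma veronese_valM x y : veronese_val (x * y) = veronese_val x * veronese_val y.
Proof. exact: (rmorphM (val : veroneseT -> A)). Qed.

Lemma veronese_val_sum n (f : nat -> veroneseT) :
  veronese_val (\sum_(i < n) f i) = \sum_(i < n) veronese_val (f i).
Proof. exact: (raddf_sum (val : veroneseT -> A)). Qed.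

Lemma veronese_comp0 k : veronese_comp k 0.
Proof. rewrite /veronese_comp /mkset veronese_val0; apply: gcomp0. Qed.

Lemma veronese_compP k (c : K) x y :
  veronese_comp k x -> veronese_comp k y -> veronese_comp k (c *: x + y).
Proof.
rewrite /veronese_comp /mkset veronese_valD veronese_valZ; exact: gcompP.
Qed.

Lemma veronese_compM i j x y :
  veronese_comp i x -> veronese_comp j y -> veronese_comp (i + j) (x * y).
Proof. by rewrite /veronese_comp /mkset veronese_valM mulnDr; apply: gcompM. Qed.

Lemma veronese_comp_deg0 x : veronese_comp 0 x <-> exists c : K, x = c%:A.
Proof.
rewrite /veronese_comp /mkset muln0; split=> [/gcomp_deg0[c hc]|[c ->]].
  by exists c; apply: veronese_val_inj; rewrite veronese_valZ veronese_val1.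
by apply/gcomp_deg0; exists c; rewrite veronese_valZ veronese_val1.
Qed.

Lemma veronese_comp_span x : exists n (f : nat -> veroneseT),
  (forall d, veronese_comp d (f d)) /\ x = \sum_(d < n) f d.
Proof.
have /veroneseP[n [f [hf ex]]] := valP x.
have hv k : f k \in veronese_pred by apply/veroneseP/gspan_gcomp/hf.
exists n, (fun k => VeroneseT (hv k)); split; first by move=> d; apply: hf.
apply: veronese_val_inj.
by rewrite (veronese_val_sum _ (fun k => VeroneseT (hv k))).
Qed.

Hypothesis e_gt0 : (0 < e)%N.

Lemma veronese_comp_direct n (f : nat -> veroneseT) :
  (forall d, veronese_comp d (f d)) -> \sum_(d < n) f d = 0 ->
  forall d, (d < n)%N -> f d = 0.
Proof.
move=> hf h0 d dn; apply: veronese_val_inj; rewrite veronese_val0.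
pose g i := if (e %| i)%N then veronese_val (f (i %/ e)%N) else 0 : A.
have hg i : gcomp i (g i).
  rewrite /g; case: ifP => [/dvdnP[k ->]|_]; last exact: gcomp0.
  by rewrite mulnK // mulnC; apply: hf.
have gE k : g (k * e)%N = veronese_val (f k) by rewrite /g dvdn_mull // mulnK.
rewrite -gE; apply: (gcomp_direct hg (n := (n * e)%N)); last by rewrite ltn_pmul2r.
transitivity (\sum_(k < n) veronese_val (f k)); last first.
  by rewrite -veronese_val_sum h0 veronese_val0.
elim: {h0 dn} n => [|n IH]; first by rewrite mul0n !big_ord0.
rewrite mulSnr big_split_ord /= IH big_ord_recr /=; congr (_ + _).
rewrite (bigD1 (Ordinal e_gt0)) //= addn0 gE big1 ?addr0 // => i ne.
have i0 : (0 < i)%N by rewrite lt0n; apply: contra ne => /eqP h; apply/eqP/val_inj.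
by rewrite /g dvdn_addr ?dvdn_mull // gtnNdvd.
Qed.

Definition veronese : gradedAlg K :=
  GradedAlg veronese_comp0 veronese_compP veronese_compM veronese_comp_deg0
    veronese_comp_span veronese_comp_direct.

End Veronese.

(* K[x_1, ..., x_n] graded by deg x_i = w i > 0. *)
Section WeightedPolynomials.
Variables (K : fieldType) (n : nat) (w : 'I_n -> nat).
Local Notation P := {mpoly K[n]}.

Definition wdeg (m : 'X_{1.. n}) : nat := (\sum_(i < n) w i * m i)%N.

Definition wcomp (d : nat) : set P :=
  [set p | forall m, m \in msupp p -> wdeg m = d].

Lemma wcomp0 d : wcomp d 0.
Proof. by move=> m; rewrite msupp0. Qed.

Lemma wcompP d (c : K) (p q : P) : wcomp d p -> wcomp d q -> wcomp d (c *: p + q).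
Proof.
move=> hp hq m /msuppD_le; rewrite mem_cat => /orP[/msuppZ_le/hp|/hq] //.
Qed.

Lemma wcompM i j (p q : P) : wcomp i p -> wcomp j q -> wcomp (i + j) (p * q).
Proof.
move=> hp hq m /msuppM_le/allpairsP[[a b] /= [/hp <- /hq <- ->]].
by rewrite /wdeg -big_split; apply: eq_bigr => k _; rewrite mnmDE mulnDr.
Qed.

Lemma wcomp_span (p : P) : exists N (f : nat -> P),
  (forall d, wcomp d (f d)) /\ p = \sum_(d < N) f d.
Proof.
exists (\max_(m <- msupp p) wdeg m).+1,
  (fun d => \sum_(m <- msupp p | wdeg m == d) p@_m *: 'X_[m]); split.
  move=> d; apply: big_ind => [|x y hx hy|m /eqP <-]; first exact: wcomp0.
    by rewrite -[x]scale1r; apply: wcompP.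
  by move=> k /msuppZ_le; rewrite msuppX inE => /eqP ->.
rewrite {1}[p]mpolyE (exchange_big_dep predT) //= big_seq [RHS]big_seq.
apply: eq_bigr => m hm.
have lt : (wdeg m < (\max_(m <- msupp p) wdeg m).+1)%N by rewrite ltnS leq_bigmax_seq.
by rewrite (big_pred1 (Ordinal lt)) // => i; rewrite -val_eqE /= eq_sym.
Qed.

Lemma wcomp_direct N (f : nat -> P) :
  (forall d, wcomp d (f d)) -> \sum_(d < N) f d = 0 ->
  forall d, (d < N)%N -> f d = 0.
Proof.
move=> hf h0 d dN; apply/mpolyP => m; rewrite mcoeff0.
apply/eqP; rewrite mcoeff_eq0; apply/negP => hm.
have ed := hf d m hm; have : (\sum_(d < N) f d)@_m = 0 by rewrite h0 mcoeff0.
rewrite raddf_sum (bigD1 (Ordinal dN)) //= big1 ?addr0.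
  by move/eqP; rewrite mcoeff_eq0 hm.
move=> i ne; apply/eqP; rewrite mcoeff_eq0; apply/negP => /hf ei.
by case/eqP: ne; apply: val_inj; rewrite /= -ei ed.
Qed.

Hypothesis w_gt0 : forall i, (0 < w i)%N.

Lemma wcomp_deg0 (p : P) : wcomp 0 p <-> exists c : K, p = c%:A.
Proof.
split=> [hp|[c ->] m]; last first.
  rewrite alg_mpolyC msuppC; case: ifP => // _; rewrite inE => /eqP ->.
  by rewrite /wdeg big1 // => i _; rewrite mnm0E muln0.
exists p@_0; rewrite alg_mpolyC; apply/mpolyP => m; rewrite mcoeffC.
have [->|ne] := eqVneq m 0%MM; first by rewrite mulr1.
rewrite mulr0; apply/eqP; rewrite mcoeff_eq0; apply/negP => /hp/eqP.
rewrite /wdeg sum_nat_eq0 => /forallP h; case/eqP: ne; apply/mnmP => i.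
have := h i; rewrite /= muln_eq0 mnm0E => /orP[/eqP wi|/eqP //].
by move: (w_gt0 i); rewrite wi.
Qed.

Definition wpoly : gradedAlg K :=
  GradedAlg wcomp0 wcompP wcompM wcomp_deg0 wcomp_span wcomp_direct.

End WeightedPolynomials.

Section Koszul.
Variables (K : fieldType) (B : gradedAlg K).

(* A complex  ... -> F_1 -> F_0 -> K -> 0  of graded free B-modules           *)
(* F_i = (+)_r B(- fdeg i r), with 0 <= r < frank i, seen as row vectors. The *)
(* matrix fdiff i acts on the right as F_(i+1) -> F_i, and F_0 -> K = B / B_+ *)
(* is v |-> v *m faug mod B_+. Finite ranks and shifts >= 0 are enough for    *)
(* the minimal resolution of K over a standard graded (hence noetherian) B.   *)
Record freeComplex := FreeComplex {
  frank : nat -> nat;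
  fdeg : forall i, 'I_(frank i) -> nat;
  fdiff : forall i, 'M[B]_(frank i.+1, frank i);
  faug : 'cV[B]_(frank 0)
}.

(* x lies in the degree d part of B(-a). *)
Definition shifted_comp (a d : nat) (x : B) : Prop :=
  if (a <= d)%N then gcomp (d - a) x else x = 0.

(* All maps have degree 0; the residue field sits in degree 0, so a generator *)
(* of positive degree must be mapped into B_+, i.e. to 0 in B / B_+.          *)
Definition is_graded (F : freeComplex) : Prop :=
  (forall i r s, shifted_comp (fdeg s) (fdeg r) (fdiff F i r s)) /\
  (forall r : 'I_(frank F 0), gcomp (fdeg r) (faug F r 0)).

Definition is_exact (F : freeComplex) : Prop :=
  [/\ exists v : 'rV[B]_(frank F 0), irrelevant B ((v *m faug F) 0 0 - 1),
      forall v : 'rV[B]_(frank F 0),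
        irrelevant B ((v *m faug F) 0 0) <-> exists u, v = u *m fdiff F 0
    & forall i (v : 'rV[B]_(frank F i.+1)),
        v *m fdiff F i = 0 <-> exists u, v = u *m fdiff F i.+1].

Definition is_minimal (F : freeComplex) : Prop :=
  forall i r s, irrelevant B (fdiff F i r s).

Definition is_linear (F : freeComplex) : Prop :=
  forall i (r : 'I_(frank F i)), fdeg r = i.

(* A minimal graded free resolution is unique up to graded isomorphism, so    *)
(* "the minimal resolution is linear" is expressed by the existence of one    *)
(* that is; the number of its generators of degree j in F_i is the dimension  *)
(* of Tor_i(K, K)_j.                                                          *)
Definition koszul : Prop :=
  exists F, [/\ is_graded F, is_exact F, is_minimal F & is_linear F].

End Koszul.

Definition nonstandard_koszul (K : fieldType) (A : gradedAlg K) : Prop :=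
  koszul (gr A).

Definition weight1479 (i : 'I_4) : nat := nth 0%N [:: 1; 4; 7; 9] i.

Lemma weight1479_gt0 i : (0 < weight1479 i)%N.
Proof. by case: i => [] [|[|[|[|]]]]. Qed.

Definition S1479 (K : fieldType) : gradedAlg K := wpoly K weight1479_gt0.

(* Main.v *)
From HB Require Import structures.
Require Import Defs.
From mathcomp Require Import all_boot all_order all_algebra.
From mathcomp Require Import mpoly zify.

(* Write e = 9q + 21. The monomials of exponents (0,0,3,q), (0,3,0,q+1),       *)
(* (3,0,0,q+2) and d = (1,1,1,q+1) lie in degree 1 of the Veronese ring, and  *)
(* the product of the first three is the cube of the fourth. Since 2d splits  *)
(* in the Veronese monoid only as d + d, quadratic relations of gr can not    *)
(* rewrite the cube of x^d, so this cubic relation is not a consequence of    *)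
(* quadratic ones. The functionals that detect it are the coefficients of     *)
(* x^(kd) on gr_k, k <= 2: they are multiplicative up to total degree 2.      *)

(** In a Koszul ring, for m in degree 2 and g in degree 1, the value f_2(m) f_1(g) depends only on
    the product m * g, although K[t]/(t^3) has nothing in degree 3 ([koszul_cubic_relation]). On gr,
    the coefficients of x^(kd) give such a truncated morphism because 2d splits only as d + d
    ([gr_coefM]). It sends the class of x^d to t and those of the other degree-one monomials to 0.
    The cubic relation would then give 0 = 1 ([rigid_not_koszul]). *)

Set Implicit Arguments.
Unset Strict Implicit.
Unset Printing Implicit Defensive.

Import GRing.Theory.
Local Open Scope ring_scope.

(* The f k are the coefficients of a ring morphism B -> K[t]/(t^3). In a      *)
(* linear resolution, m * g = m' * g' lifts to a syzygy of F_1 generated by   *)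
(* syzygies with entries in B_1, which f 2 (x) f 1 kills.                     *)
Lemma koszul_cubic_relation (K : fieldType) (B : gradedAlg K)
    (f : nat -> {additive B -> K}) :
    (forall k x y, (k <= 2)%N -> f k (x * y) = \sum_(i < k.+1) f i x * f (k - i)%N y) ->
    (forall i j x, gcomp i x -> i != j -> f j x = 0) ->
    koszul B ->
  forall m g m' g', gcomp 2 m -> gcomp 1 g -> gcomp 2 m' -> gcomp 1 g' ->
    m * g = m' * g' -> f 2 m * f 1 g = f 2 m' * f 1 g'.
Proof.
move=> fM f_gcomp [F [[gD _] [[v0 hv0] im0 ex] _ lin]].
(* If F_0 had rank 0, the augmentation would vanish and 1 would lie in B_+. *)
have r0 : 'I_(frank F 0).
  case: (frank F 0) (faug F) (v0) hv0 => [a v|n *]; last exact: ord0.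
  rewrite mxE big_ord0 sub0r => h.
  have /irrelevant1 [] : irrelevant B 1.
  by rewrite -[1]opprK -mulN1r; apply: irrelevantM.
have D1 i r s : gcomp 1 (fdiff F i r s).
  by have := gD i r s; rewrite /shifted_comp !lin leqnSn subSnn.
have f1M x a : gcomp 1 a -> f 1%N (x * a) = f 0%N x * f 1%N a.
  by move=> ha; rewrite fM // !big_ord_recl big_ord0 /= (f_gcomp 1 0 a)%N // mulr0 !addr0.
have f2M x a : gcomp 1 a -> f 2 (x * a) = f 1%N x * f 1%N a.
  move=> ha; rewrite fM // !big_ord_recl big_ord0 /= (f_gcomp 1 0 a)%N //.
  by rewrite (f_gcomp 1 2 a)%N // !mulr0 !addr0 add0r.
have f2Ml x a : gcomp 2 x -> f 2 (x * a) = f 2 x * f 0%N a.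
  move=> hx; rewrite fM // !big_ord_recl big_ord0 /= (f_gcomp 2 0 x)%N //.
  by rewrite (f_gcomp 2 1 x)%N // !mul0r !add0r addr0.
have lift g : gcomp 1 g ->
      exists u, g *: (delta_mx 0 r0 : 'rV_(frank F 0)) = u *m fdiff F 0.
  move=> hg; apply/(im0 (g *: delta_mx 0 r0)); rewrite -scalemxAl mxE mulrC; apply: irrelevantM.
  exact: (@gspan_gcomp _ _ succn 0).
(* The lift u need not be homogeneous: since m and the entries of the differential are, only the
   values f_0(u_r) enter. *)
have fg m g (u : 'rV_(frank F 1)) : gcomp 2 m -> gcomp 1 g -> g *: delta_mx 0 r0 = u *m fdiff F 0 ->
    f 2 m * f 1%N g = \sum_r f 2 (m * u 0 r) * f 1%N (fdiff F 0 r r0).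
  move=> hm hg /matrixP/(_ 0 r0); rewrite !mxE !eqxx mulr1 => ->.
  rewrite raddf_sum big_distrr; apply: eq_bigr => r _ /=.
  by rewrite f1M // f2Ml // mulrA.
move=> m g m' g' hm hg hm' hg' eq.
have [u hu] := lift g hg; have [u' hu'] := lift g' hg'.
have /ex[t ht] : (m *: u - m' *: u') *m fdiff F 0 = 0.
  by rewrite mulmxBl -!scalemxAl -hu -hu' !scalerA eq subrr.
apply/eqP; rewrite -subr_eq0 (fg m g u) // (fg m' g' u') // -sumrB; apply/eqP.
(* Regrouping f_1(t_s) f_1(D') f_1(D) as f_1(t_s) f_2(D' D) brings out the composite of two
   differentials, which is zero. *)
transitivity (\sum_r \sum_s f 1%N (t 0 s) * f 2 (fdiff F 1 s r * fdiff F 0 r r0)).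
  apply: eq_bigr => r _; rewrite -mulrBl -raddfB.
  have /matrixP/(_ 0 r) := ht; rewrite !mxE => ->.
  rewrite raddf_sum big_distrl; apply: eq_bigr => s _ /=.
  by rewrite f2M // f2M // mulrA.
rewrite exchange_big big1 // => s _; rewrite -big_distrr -raddf_sum /=.
have /ex/(congr1 (fun M : 'rV_ _ => M 0 r0)) : exists v, row s (fdiff F 1) = v *m fdiff F 1.
  by exists (delta_mx 0 s); rewrite rowE.
rewrite !mxE => h; rewrite (_ : \sum_ _ _ = 0) ?raddf0 ?mulr0 // -[RHS]h.
by apply: eq_bigr => r _; rewrite !mxE.
Qed.

(** * Coefficient functionals on the associated graded ring of a Veronese ring *)

Section VeroneseGr.
Variables (K : fieldType) (n : nat) (w : 'I_n -> nat).
Hypothesis w_gt0 : forall i, (0 < w i)%N.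
Variables (e : nat) (e_gt0 : (0 < e)%N).
Local Notation A := (veronese (wpoly K w_gt0) e_gt0).
Local Notation vval := (@veronese_val K (wpoly K w_gt0) e).
Local Notation mX := (idealX (irrelevant A)).

Definition vcoef (m : 'X_{1.. n}) (x : A) : K := (vval x : {mpoly K[n]})@_m.

Lemma wdegD (m1 m2 : 'X_{1.. n}) :
  wdeg w (m1 + m2)%MM = (wdeg w m1 + wdeg w m2)%N.
Proof. by rewrite /wdeg -big_split; apply: eq_bigr => i _; rewrite mnmDE mulnDr. Qed.

Lemma wdeg_eq0 (m : 'X_{1.. n}) : wdeg w m = 0%N -> m = 0%MM.
Proof.
move=> /eqP; rewrite /wdeg sum_nat_eq0 => /forallP h; apply/mnmP => i.
by have := h i; rewrite /= muln_eq0 gtn_eqF // mnm0E => /eqP.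
Qed.

Lemma vcoef_zmod m : zmod_morphism (vcoef m).
Proof.
move=> x y; rewrite /vcoef -[- y]scaleN1r veronese_valD veronese_valZ.
by rewrite scaleN1r mcoeffB.
Qed.

HB.instance Definition _ m :=
  GRing.isZmodMorphism.Build A K (vcoef m) (vcoef_zmod m).

Lemma vcoefM_neq0 m x y : vcoef m (x * y) != 0 ->
  exists m1 m2, [/\ m = (m1 + m2)%MM, vcoef m1 x != 0 & vcoef m2 y != 0].
Proof.
rewrite /vcoef veronese_valM -mcoeff_msupp => /msuppM_le/allpairsP[[m1 m2] /= [h1 h2 ->]].
by exists m1, m2; rewrite -!mcoeff_msupp.
Qed.

Lemma vcoefM_unique a b x y :
  (forall m1 m2, (a + b = m1 + m2)%MM -> vcoef m1 x != 0 -> vcoef m2 y != 0 ->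
    m1 = a /\ m2 = b) ->
  vcoef (a + b)%MM (x * y) = vcoef a x * vcoef b y.
Proof.
move=> ab; have la : (mdeg a < (mdeg (a + b)).+1)%N by rewrite mdegD ltnS leq_addr.
have lb : (mdeg b < (mdeg (a + b)).+1)%N by rewrite mdegD ltnS leq_addl.
rewrite {1}/vcoef veronese_valM mcoeffM.
rewrite (bigD1 (BMultinom la, BMultinom lb)) //= big1 ?addr0 // => -[m1 m2] /=.
move=> /andP[/eqP eq ne]; apply/eqP; apply: contraNT ne.
rewrite mulf_eq0 negb_or => /andP[/(ab _ _ eq) ab2 /ab2[e1 e2]].
by apply/eqP; congr pair; apply: val_inj.
Qed.

Lemma vcoef_irrelevant m x : irrelevant A x -> vcoef m x != 0 -> (e <= wdeg w m)%N.
Proof.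
move=> [N [f [hf ->]]]; apply: contraNT; rewrite -ltnNge => lt.
rewrite raddf_sum big1 // => i _; apply/eqP; apply: contraLR lt.
rewrite /vcoef -mcoeff_msupp => h; have := hf i _ h.
by rewrite -leqNgt => ->; rewrite leq_pmulr.
Qed.

(** A_+ starts in weight e, so each of the k factors contributes at least e. *)
Lemma vcoef_mX k m x : mX k x -> vcoef m x != 0 -> (k * e <= wdeg w m)%N.
Proof.
elim: k m x => [//|k IH] m x [s hs ->]; apply: contraNT; rewrite -ltnNge => lt.
rewrite raddf_sum big_seq big1 // => p /hs[h1 h2]; apply/eqP; apply: contraLR lt.
case/vcoefM_neq0 => m1 [m2 [-> /(vcoef_irrelevant h1) l1 /(IH _ _ h2) l2]].
by rewrite -leqNgt wdegD mulSn leq_add.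
Qed.

Variable d : 'X_{1.. n}.
Hypothesis wdeg_d : wdeg w d = e.

Lemma wdegMn k : wdeg w (d *+ k)%MM = (k * e)%N.
Proof.
elim: k => [|k IH]; last by rewrite mulmS wdegD IH wdeg_d.
by rewrite mulm0n /wdeg big1 // => i _; rewrite mnm0E muln0.
Qed.

(** The choice of representative is harmless ([gr_coef_pi]): x^(kd) has weight k e, too small to
    occur in m^(k+1). *)
Definition gr_coef (k : nat) (x : gr A) : K :=
  vcoef (d *+ k)%MM (rees_val (repr (x : grT A)))`_k.

Lemma gr_coef_pi k (p : reesRing A) :
  gr_coef k (gr_pi p) = vcoef (d *+ k)%MM (rees_val p)`_k.
Proof.
set q := repr (gr_pi p : grT A).
have /gr_piP/(_ k) h : gr_pi q = gr_pi p by rewrite /gr_pi reprK.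
rewrite /gr_coef -/q -[q in LHS](subrK p) rmorphD coefD raddfD.
rewrite [X in X + _](_ : _ = 0) ?add0r //; apply/eqP; apply: contraT.
by move/(vcoef_mX h); rewrite wdegMn leq_pmul2r // ltnn.
Qed.

Lemma gr_coef_zmod k : zmod_morphism (gr_coef k).
Proof.
move=> x y; have [p ->] := gr_pi_surj x; have [q ->] := gr_pi_surj y.
rewrite -(raddfB (@gr_pi K A)) !gr_coef_pi raddfB coefB.
exact: raddfB.
Qed.

HB.instance Definition _ k :=
  GRing.isZmodMorphism.Build (gr A) K (gr_coef k) (gr_coef_zmod k).

Lemma gr_coef_gcomp i j x : gcomp i x -> i != j -> gr_coef j x = 0.
Proof.
move=> [a [ha ->]] ij; rewrite gr_coef_pi /= coefZ coefXn eq_sym (negbTE ij).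
by rewrite mulr0 raddf0.
Qed.

Hypothesis d_rigid : forall m1 m2, (d + d = m1 + m2)%MM ->
  wdeg w m1 = e -> wdeg w m2 = e -> m1 = d.

(** The weights add up to (i + j) e, so both lower bounds are equalities. A part of weight 0 is
    trivial, which leaves i = j = 1, the rigidity of 2d. *)
Lemma wdeg_split i j m1 m2 : (i + j <= 2)%N -> (d *+ i + d *+ j = m1 + m2)%MM ->
  (i * e <= wdeg w m1)%N -> (j * e <= wdeg w m2)%N ->
  m1 = (d *+ i)%MM /\ m2 = (d *+ j)%MM.
Proof.
move=> ij eq le1 le2; have := congr1 (wdeg w) eq.
rewrite !wdegD !wdegMn => eqw.
have [h1 h2] : wdeg w m1 = (i * e)%N /\ wdeg w m2 = (j * e)%N by lia.
have [i0|i_gt0] := posnP i.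
  have m10 : m1 = 0%MM by apply: wdeg_eq0; rewrite h1 i0.
  by move: eq; rewrite i0 m10 mulm0n !add0m.
have [j0|j_gt0] := posnP j.
  have m20 : m2 = 0%MM by apply: wdeg_eq0; rewrite h2 j0.
  by move: eq; rewrite j0 m20 mulm0n !addm0.
have [i1 j1] : i = 1%N /\ j = 1%N by lia.
rewrite i1 j1 !mulm1n !mul1n in eq h1 h2 *; rewrite (d_rigid eq) //.
by rewrite (@d_rigid m2 m1) // addmC.
Qed.

Lemma gr_coefM k x y : (k <= 2)%N ->
  gr_coef k (x * y) = \sum_(i < k.+1) gr_coef i x * gr_coef (k - i)%N y.
Proof.
move=> k2; have [p ->] := gr_pi_surj x; have [q ->] := gr_pi_surj y.
rewrite -(rmorphM (@gr_pi K A)) gr_coef_pi rmorphM coefM raddf_sum.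
apply: eq_bigr => i _; rewrite !gr_coef_pi.
have /reesP/(_ i) hp := valP p; have /reesP/(_ (k - i)%N) hq := valP q.
have ik : (i + (k - i))%N = k by rewrite subnKC // -ltnS.
have dik : (d *+ k = d *+ i + d *+ (k - i))%MM.
  by apply/mnmP=> l; rewrite mnmDE !mulmnE -mulnDr ik.
rewrite dik; apply: vcoefM_unique => m1 m2 eq n1 n2.
apply: wdeg_split eq (vcoef_mX hp n1) (vcoef_mX hq n2).
by rewrite ik.
Qed.

(** * Classes of degree-one monomials and the cubic relation *)

Lemma atom_subproof m : wdeg w m = e ->
  ('X_[m] : wpoly K w_gt0) \in @veronese_pred K (wpoly K w_gt0) e.
Proof.
move=> hm; apply/veroneseP/(@gspan_gcomp _ _ _ 1) => k.
by rewrite msuppX inE => /eqP ->; rewrite muln1.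
Qed.

Definition atom m (hm : wdeg w m = e) : A := VeroneseT (atom_subproof hm).

Lemma atom_mX1 m (hm : wdeg w m = e) : mX 1 (atom hm).
Proof.
apply/mX1E/(@gspan_gcomp _ _ _ 0) => k.
by rewrite msuppX inE => /eqP ->; rewrite muln1.
Qed.

Definition gr_atom m (hm : wdeg w m = e) : gr A :=
  gr_pi (rees_monomial (atom_mX1 hm)).

Lemma gr_atom_gcomp m (hm : wdeg w m = e) : gcomp 1 (gr_atom hm).
Proof. by exists (atom hm), (atom_mX1 hm). Qed.

Lemma gr_coef1_atom m (hm : wdeg w m = e) : gr_coef 1 (gr_atom hm) = (m == d)%:R.
Proof.
by rewrite gr_coef_pi /= coefZ coefXn eqxx mulr1 mulm1n /vcoef mcoeffX.
Qed.

(** Both sides are the same monomial, so they agree already in the Rees ring. *)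
Lemma gr_atomM3 a b c (ha : wdeg w a = e) (hb : wdeg w b = e) (hc : wdeg w c = e)
    (a' b' c' : 'X_{1.. n}) (ha' : wdeg w a' = e) (hb' : wdeg w b' = e)
    (hc' : wdeg w c' = e) : (a + b + c = a' + b' + c')%MM ->
  gr_atom ha * gr_atom hb * gr_atom hc = gr_atom ha' * gr_atom hb' * gr_atom hc'.
Proof.
move=> eq; rewrite /gr_atom -!(rmorphM (@gr_pi K A)); congr gr_pi.
apply: rees_val_inj; rewrite !rees_valM /= -!(scalerAl, scalerAr) !scalerA.
congr (_ *: _); apply: veronese_val_inj.
by rewrite !veronese_valM /= -!mpolyXD addmC eq addmC.
Qed.

Lemma rigid_not_koszul a b c : wdeg w a = e -> wdeg w b = e -> wdeg w c = e ->
  (a + b + c = d + d + d)%MM -> c != d -> ~ koszul (gr A).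
Proof.
move=> ha hb hc eq cd kos.
have gM2 m1 m2 (h1 : wdeg w m1 = e) (h2 : wdeg w m2 = e) :
    gcomp 2 (gr_atom h1 * gr_atom h2).
  exact: (@gcompM _ _ 1 1 _ _ (gr_atom_gcomp h1) (gr_atom_gcomp h2)).
have := koszul_cubic_relation gr_coefM gr_coef_gcomp kos
  (gM2 _ _ ha hb) (gr_atom_gcomp hc) (gM2 _ _ wdeg_d wdeg_d)
  (gr_atom_gcomp wdeg_d) (gr_atomM3 ha hb hc wdeg_d wdeg_d wdeg_d eq).
rewrite /= !gr_coefM // !big_ord_recl !big_ord0 /=.
have coef0 m (hm : wdeg w m = e) : gr_coef 0 (gr_atom hm) = 0.
  exact: gr_coef_gcomp (gr_atom_gcomp hm) _.
rewrite !coef0 !gr_coef1_atom eqxx (negbTE cd) !(mul0r, mulr0, add0r, addr0, mul1r).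
by move/eqP; rewrite eq_sym oner_eq0.
Qed.
End VeroneseGr.

(** * Exponents in four variables with weights 1, 4, 7, 9 *)

Definition mnm4 (a b c d : nat) : 'X_{1.. 4} :=
  [multinom nth 0%N [:: a; b; c; d] i | i < 4].

Lemma mnm4E (m : 'X_{1.. 4}) : exists a b c d, m = mnm4 a b c d.
Proof.
exists (m (inord 0)), (m (inord 1)), (m (inord 2)), (m (inord 3)).
apply/mnmP => i; rewrite mnmE -[in LHS](inord_val i).
by case: i => [[|[|[|[|]]]]].
Qed.

Lemma mnm4D a b c d a' b' c' d' :
  (mnm4 a b c d + mnm4 a' b' c' d' = mnm4 (a + a') (b + b') (c + c') (d + d'))%MM.
Proof. by apply/mnmP => i; rewrite mnmDE !mnmE; case: i => [[|[|[|[|]]]]]. Qed.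

Lemma mnm4_inj a b c d a' b' c' d' : mnm4 a b c d = mnm4 a' b' c' d' ->
  [/\ a = a', b = b', c = c' & d = d'].
Proof.
move/mnmP => h.
by split; [have := h (inord 0) | have := h (inord 1) | have := h (inord 2) |
  have := h (inord 3)]; rewrite !mnmE inordK.
Qed.

Lemma wdeg1479 a b c d :
  wdeg weight1479 (mnm4 a b c d) = (a + 4 * b + 7 * c + 9 * d)%N.
Proof.
by rewrite /wdeg !big_ord_recl big_ord0 !mnmE /= mul1n addn0 !addnA.
Qed.

Theorem theorem1 (K : fieldType) (e : nat) (e_gt0 : (0 < e)%N) :
  (21 <= e)%N -> (e = 3 %[mod 9])%N ->
  ~ nonstandard_koszul (veronese (S1479 K) e_gt0).
Proof.
(* The bound 21 makes q, the exponent of x_4 in (0,0,3,q), nonnegative. *)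
move=> e21 e3; have [q eq] : exists q, e = (9 * q + 21)%N.
  by exists ((e - 21) %/ 9)%N; lia.
have wq a b c d : (a + 4 * b + 7 * c + 9 * d = 9 * q + 21)%N ->
    wdeg weight1479 (mnm4 a b c d) = e by rewrite wdeg1479 eq.
apply: (@rigid_not_koszul _ _ _ _ _ _ (mnm4 1 1 1 q.+1) _ _
  (mnm4 0 0 3 q) (mnm4 0 3 0 q.+1) (mnm4 3 0 0 q.+2)).
- by apply: wq; lia.
- move=> m1 m2; have [a [b [c [d ->]]]] := mnm4E m1.
  have [a' [b' [c' [d' ->]]]] := mnm4E m2.
  rewrite !mnm4D !wdeg1479 eq => /mnm4_inj[? ? ? ?] ? ?.
  (* The exponents a, b, c are at most 2, and in that range a + 4b + 7c = 3 mod 9 has the single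
     solution (1,1,1); the weight then fixes d. *)
  have [-> -> -> ->] : [/\ a = 1, b = 1, c = 1 & d = q.+1]%N by split; lia.
  by [].
- by apply: wq; lia.
- by apply: wq; lia.
- by apply: wq; lia.
- by rewrite !mnm4D; congr mnm4; lia.
- by apply/eqP => /mnm4_inj[].
Qed.
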